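(* Let $G$ be a strongly regular graph with parameters $(n,k,a,c)$, and let $G\times G$ be the Cartesian product of $G$ with itself. For vertices $(u_1,v_1),(u_2,v_2)$ of $G\times G$ write $d=d_{G\times G}((u_1,v_1),(u_2,v_2))$. Then $H(G\times G;((u_1,v_1),(u_2,v_2)))$ equals: - $0$ if $(u_1,v_1)=(u_2,v_2)$; - $n^2-1$ if $d=1$; - $\dfrac{-c(n^2-1)(a-2k-1)+c^2(n^2-1)+k(k+n+1)}{c(-a+c+2k)}$ if $d=2$ and ($u_1=u_2$ or $v_1=v_2$); - $\dfrac{-a(n^2+n-2)+c(n^2+n-2)+2kn^2+kn-4k+n^2-n}{-a+c+2k}$ if $d=2$ and $u_1\ne u_2$ and $v_1\neq v_2$; - $\dfrac{c\left(-a(n^2+n-2)+k(2n^2+n-4)+n^2-1\right)+c^2(n^2+n-2)+k(k+n+1)}{c(-a+c+2k)}$ if $d=3$; - $\dfrac{c\left(-a(n^2+n-2)+k(2n^2+n-4)+n^2+n-2\right)+c^2(n^2+n-2)+k(2k+n+2)}{c(-a+c+2k)}$ if $d=4$.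
   Context: Graphs are finite, simple and undirected; $d_G$ is the graph distance in $G$. $H(G;(v,u))$ denotes the average hitting time from $u$ to $v$: the expected number of steps needed to reach $v$ for the first time in a simple random walk on $G$ (each step moves to a uniformly chosen neighbour) starting from $u$, with $H(G;(v,v))=0$. A $k$-regular connected graph $G$ of diameter $\Delta$ is distance-regular with intersection array $\{b_0=k,b_1,\ldots,b_{\Delta-1};c_1=1,\ldots,c_{\Delta}\}$ if for any vertices $u,v$ at distance $i$ there are exactly $c_i$ neighbours of $u$ at distance $i-1$ from $v$ and exactly $b_i$ neighbours of $u$ at distance $i+1$ from $v$. A strongly regular graph is a distance-regular graph of diameter $2$; its parameters are $(n,k,a,c)$, where $n$ is the number of vertices, $k=b_0$ is the valency, $a=k-b_1-1$ and $c=c_2$ (i.e. adjacent vertices have $a$ common neighbours, vertices at distance 2 have $c$ common neighbours). Cartesian product $G\times G'$: vertex set $V\times V'$, with $(u,u')$ adjacent to $(v,v')$ iff ($u=v$ and $u'\sim v'$) or ($u\sim v$ and $u'=v'$). *)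

(* Defs.v *)
From HB Require Import structures.
From mathcomp Require Import all_boot all_order all_algebra.
From mathcomp Require Import all_classical all_reals all_analysis.

Set Implicit Arguments.
Unset Strict Implicit.
Unset Printing Implicit Defensive.

Import Order.TTheory GRing.Theory Num.Theory.

Local Open Scope classical_set_scope.
Local Open Scope ring_scope.

Section Graphs.
Variable V : finType.
Implicit Types (e : rel V) (u v w : V).

(* A finite simple graph on V is a symmetric irreflexive relation e on V. *)
Definition simple_graph e := symmetric e /\ irreflexive e.

Definition degree e u : nat := #|[pred w | e u w]|.

Definition connected_graph e := forall u v, connect e u v.

Definition has_walk e u v (l : nat) : bool :=
  [exists p : l.-tuple V, path e u p && (last u p == v)].

(* Least length of a walk from u to v.  A shortest walk has length < #|V|, so
   the value #|V| is taken exactly when v is not reachable from u. *)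
Definition gdist e u v : nat := find (has_walk e u v) (iota 0 #|V|).

Definition diameter e : nat := \max_(u : V) \max_(v : V) gdist e u v.

(* The array is {b 0, ..., b D.-1; c 1, ..., c D}; the values of b and c
   outside these ranges are irrelevant. *)
Definition distance_regular e (D : nat) (b c : nat -> nat) :=
  [/\ simple_graph e,
      connected_graph e,
      forall u, degree e u = b 0,
      diameter e = D &
      forall u v,
        ((0 < gdist e u v)%N ->
          #|[pred w | e u w & (gdist e w v).+1 == gdist e u v]|
            = c (gdist e u v)) /\
        ((gdist e u v < D)%N ->
          #|[pred w | e u w & gdist e w v == (gdist e u v).+1]|
            = b (gdist e u v))].

Definition strongly_regular e (n k a c : nat) :=
  exists b c_ : nat -> nat,
    [/\ distance_regular e 2 b c_,
        #|V| = n, b 0 = k, (a + b 1 + 1)%N = k & c_ 2 = c].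

End Graphs.

Definition cartesian_product (V V' : finType) (e : rel V) (e' : rel V') :
    rel (V * V')%type :=
  fun x y => (x.1 == y.1) && e' x.2 y.2 || e x.1 y.1 && (x.2 == y.2).

Section RandomWalk.
Variable V : finType.
Variables (R : realType) (d : measure_display) (Omega : measurableType d).
Implicit Types (e : rel V) (u v : V) (P : probability Omega R)
  (X : nat -> Omega -> V).

Definition step_prob e u v : R := if e u v then (degree e u)%:R^-1 else 0.

(* Given any past x 0, ..., x t, the next position is a uniformly chosen
   neighbour of x t. *)
Definition simple_random_walk e u P X :=
  [/\ forall t v, measurable [set w | X t w = v],
      P [set w | X 0 w = u] = 1%E &
      forall (t : nat) (x : nat -> V),
        P [set w | forall i, (i <= t.+1)%N -> X i w = x i] =
        (P [set w | forall i, (i <= t)%N -> X i w = x i]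
          * (step_prob e (x t) (x t.+1))%:E)%E].

(* +oo if v is never visited *)
Definition hitting_time X v (w : Omega) : \bar R :=
  ereal_inf [set (t%:R)%:E | t in [set t | X t w = v]].

Definition average_hitting_time P X v : \bar R :=
  (\int[P]_w hitting_time X v w)%E.

End RandomWalk.

(* Main.v *)
(* If h vanishes at v and h x = 1 + sum_y p(x, y) h y for x <> v, then h >= 0 by
   the minimum principle, and summing over the walk killed at v gives
   sum_(s < t) P(T > s) = h u - M t, where M t = E[h(X t); T > t].  So
   sum_t P(T > t) converges, hence M t <= C P(T > t) tends to 0 and
   E T = sum_t P(T > t) = h u.
   In G x G the first-step equations only involve the pair of distances of the
   two coordinates to the target, so it suffices to check that the table of
   claimed values solves the resulting linear system; this uses the relation
   k b_1 = c (n - k - 1). *)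
Require Import Defs.
From mathcomp Require Import all_boot all_order all_algebra.
From mathcomp Require Import all_classical all_reals all_analysis.
From mathcomp Require Import zify ring lra.

Set Implicit Arguments.
Unset Strict Implicit.
Unset Printing Implicit Defensive.

Import Order.TTheory GRing.Theory Num.Theory.
Import numFieldNormedType.Exports.

Local Open Scope classical_set_scope.
Local Open Scope ring_scope.

(** * Walks and graph distance *)

Section Walks.
Variable V : finType.
Implicit Types (e : rel V) (u v w : V).

Lemma has_walkP e u v l :
  reflect (exists p, [/\ size p = l, path e u p & last u p = v]) (has_walk e u v l).
Proof.
apply: (iffP existsP) => [[p /andP[pp /eqP lp]]|[p [sp pp lp]]].
  by exists p; rewrite size_tuple.
have sp' : size p == l by apply/eqP.
by exists (Tuple sp'); rewrite /= pp lp eqxx.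
Qed.

Lemma has_walk0 e u v : has_walk e u v 0 = (u == v).
Proof.
apply/has_walkP/eqP => [[p [/size0nil-> _ //]]|->]; by exists [::].
Qed.

Lemma has_walkS e u v l :
  has_walk e u v l.+1 = [exists w, e u w && has_walk e w v l].
Proof.
apply/has_walkP/existsP => [[[|w p] []//= [sp] /andP[euw pp] lp]|].
  by exists w; rewrite euw; apply/has_walkP; exists p.
case=> w /andP[euw /has_walkP[p [sp pp lp]]].
by exists (w :: p); rewrite /= sp euw.
Qed.

Lemma has_walk1 e u v : has_walk e u v 1 = e u v.
Proof.
rewrite has_walkS; apply/existsP/idP => [[w]|euv].
  by rewrite has_walk0 => /andP[+ /eqP <-].
by exists v; rewrite euv has_walk0 eqxx.
Qed.

(** A walk without repeated vertices has length below [#|V|], so the search defining [gdist]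
    succeeds before its default value. *)
Lemma has_walk_gdist e u v : connect e u v -> has_walk e u v (gdist e u v).
Proof.
move=> /connectP[p pp lp].
have : has (has_walk e u v) (iota 0 #|V|).
  case/shortenP: pp lp => p' pp' up' _ lp'.
  apply/hasP; exists (size p'); last by apply/has_walkP; exists p'.
  by rewrite mem_iota add0n; have := max_card (mem (u :: p')); rewrite (card_uniqP up').
move=> h; have := nth_find 0%N h.
by rewrite nth_iota // -[X in (_ < X)%N](size_iota 0) -has_find.
Qed.

Lemma gdist_le e u v l : has_walk e u v l -> (gdist e u v <= l)%N.
Proof.
move=> wl; rewrite leqNgt; apply/negP => ltl.
(* [find] never exceeds the length [#|V|] of its list, so [l] lies in the searched range. *)
have lV : (l < #|V|)%N.
  by apply: leq_trans ltl _; rewrite -[X in (_ <= X)%N](size_iota 0); apply: find_size.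
by have := before_find 0%N ltl; rewrite nth_iota // add0n wl.
Qed.

Lemma has_walk_connect e u v l : has_walk e u v l -> connect e u v.
Proof. by move=> /has_walkP[p [_ pp lp]]; apply/connectP; exists p. Qed.

End Walks.

(** * Distances in a Cartesian product *)

Section CartesianProduct.
Variables (V V' : finType) (e : rel V) (e' : rel V').

(** A walk in the product interleaves one walk per coordinate. Conversely, run the walk in the first
    coordinate, then the one in the second. *)
Lemma has_walk_cartesian x y l :
  reflect (exists i j, [/\ (i + j)%N = l, has_walk e x.1 y.1 i & has_walk e' x.2 y.2 j])
    (has_walk (cartesian_product e e') x y l).
Proof.
apply: (iffP idP).
  elim: l x => [|l IH] x.
    rewrite has_walk0 => /eqP->; exists 0%N, 0%N.
    by rewrite !has_walk0 !eqxx.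
  rewrite has_walkS => /existsP[z /andP[exz /IH[i [j [<- wi wj]]]]].
  case/orP: exz => /andP[].
    move=> /eqP xz ez; exists i, j.+1; rewrite addnS xz wi; split=> //.
    by rewrite has_walkS; apply/existsP; exists z.2; rewrite ez.
  move=> ez /eqP xz; exists i.+1, j; rewrite addSn xz wj; split=> //.
  by rewrite has_walkS; apply/existsP; exists z.1; rewrite ez.
case: x => x x' [i [j [<- /=]]]; elim: i x => [|i IH] x /=.
  rewrite has_walk0 => /eqP->; rewrite add0n.
  elim: j x' => [|j IH] x'.
    rewrite !has_walk0 => /eqP->; by case: y.
  rewrite !has_walkS => /existsP[z /andP[ez /IH w]]; apply/existsP; exists (y.1, z).
  by rewrite w /cartesian_product /= eqxx ez.
rewrite addSn !has_walkS => /existsP[z /andP[ez wz]] wj.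
apply/existsP; exists (z, x'); rewrite (IH z wz wj) andbT.
by rewrite /cartesian_product /= eqxx ez orbT.
Qed.

Lemma gdist_cartesian x y : connected_graph e -> connected_graph e' ->
  gdist (cartesian_product e e') x y = (gdist e x.1 y.1 + gdist e' x.2 y.2)%N.
Proof.
move=> ce ce'.
have w : has_walk (cartesian_product e e') x y (gdist e x.1 y.1 + gdist e' x.2 y.2).
  by apply/has_walk_cartesian; do 2!eexists; split; first reflexivity;
     exact: has_walk_gdist.
apply/eqP; rewrite eqn_leq gdist_le //=.
have /has_walk_cartesian[i [j [<- wi wj]]] := has_walk_gdist (has_walk_connect w).
by rewrite leq_add // gdist_le.
Qed.

End CartesianProduct.

(** * Neighbour counts in strongly regular graphs *)

Section StronglyRegular.
Variables (V : finType) (e : rel V) (n k a c : nat).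
Hypothesis hG : strongly_regular e n k a c.

Lemma srg_simple : simple_graph e.
Proof. by case: hG => b [c_ [[]]]. Qed.

Lemma srg_connected : connected_graph e.
Proof. by case: hG => b [c_ [[]]]. Qed.

Lemma srg_card : #|V| = n.
Proof. by case: hG => b [c_ []]. Qed.

Lemma srg_degree u : degree e u = k.
Proof. by case: hG => b [c_ [[_ _ -> _ _] _ ->]]. Qed.

Lemma srg_gdist_le2 u v : (gdist e u v <= 2)%N.
Proof.
case: hG => b [c_ [[_ _ _ <- _] _ _ _ _]].
by apply: leq_trans (leq_bigmax u); apply: (leq_bigmax v).
Qed.

Lemma gdist_eq0 u v : (gdist e u v == 0)%N = (u == v).
Proof.
apply/idP/idP => [/eqP d0|/eqP->]; last first.
  by rewrite -leqn0; apply: gdist_le; rewrite has_walk0.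
by have := has_walk_gdist (srg_connected u v); rewrite d0 has_walk0.
Qed.

Lemma gdist_eq1 u v : (gdist e u v == 1)%N = e u v.
Proof.
apply/idP/idP => [/eqP d1|euv].
  by have := has_walk_gdist (srg_connected u v); rewrite d1 has_walk1.
rewrite eqn_leq gdist_le ?has_walk1 //= lt0n gdist_eq0.
by apply: contraTneq euv => ->; rewrite srg_simple.2.
Qed.

Lemma gdist_srg u v : gdist e u v = (if u == v then 0 else if e u v then 1 else 2)%N.
Proof.
rewrite -gdist_eq0 -gdist_eq1; have := srg_gdist_le2 u v.
by case: (gdist e u v) => [|[|[|]]].
Qed.

Lemma gdist_srgC u v : gdist e u v = gdist e v u.
Proof. by rewrite !gdist_srg eq_sym srg_simple.1. Qed.

Lemma srg_a_lt : (a < k)%N.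
Proof. by case: hG => b [c_ [_ _ _ <- _]]; lia. Qed.

Lemma srg_card_nbr_far u v : gdist e u v = 1%N ->
  #|[pred w | e u w & gdist e w v == 2%N]| = (k - a.+1)%N.
Proof.
case: hG => b [c_ [[_ _ _ _ h] _ _ hk _]] d1.
have := (h u v).2; rewrite d1 => ->//; lia.
Qed.

Lemma srg_card_nbr_near u v : gdist e u v = 2%N ->
  #|[pred w | e u w & gdist e w v == 1%N]| = c.
Proof.
case: hG => b [c_ [[_ _ _ _ h] _ _ _ <-]] d2.
by have := (h u v).1; rewrite d2 => <-.
Qed.

(** Otherwise the diameter would be at most 1. Such a pair ties [c] to an actual neighbour count,
    which yields [0 < c] and [c <= k]. *)
Lemma srg_gdist2_ex : exists u v, gdist e u v = 2%N.
Proof.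
case: (boolP [exists u, exists v, gdist e u v == 2%N]).
  by move=> /existsP[u /existsP[v /eqP]]; exists u, v.
move=> /existsPn nd; case: hG => b [c_ [[_ _ _ D _] _ _ _ _]].
suff : (diameter e <= 1)%N by rewrite D.
apply/bigmax_leqP => u _; apply/bigmax_leqP => v _.
by have /existsPn/(_ v) := nd u; have := srg_gdist_le2 u v; lia.
Qed.

Lemma srg_c_gt0 : (0 < c)%N.
Proof.
have [u [v d2]] := srg_gdist2_ex.
rewrite -(srg_card_nbr_near d2); have := has_walk_gdist (srg_connected u v).
rewrite d2 has_walkS => /existsP[w /andP[euw]]; rewrite has_walk1 => ewv.
by apply/card_gt0P; exists w; rewrite inE euw gdist_eq1.
Qed.

(** Sort the neighbours of [u] by their distance to [v]. The number at distance 0 is [e u v], a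
    second count comes from the intersection array (or is zero when [u = v]), and the degree [k]
    fixes the third. *)
Lemma srg_sum_nbr (M : nmodType) (G : nat -> M) u v :
  \sum_(w | e u w) G (gdist e w v) =
  match gdist e u v with
  | 0 => G 1%N *+ k
  | 1 => G 0%N + G 1%N *+ a + G 2%N *+ (k - a.+1)
  | _ => G 1%N *+ c + G 2%N *+ (k - c)
  end.
Proof.
have sumE i (P : pred V) :
    \sum_(w | P w && (gdist e w v == i)) G (gdist e w v) =
    G i *+ #|[pred w | P w & gdist e w v == i]|.
  by rewrite -sumr_const; apply: eq_big => // w /andP[_ /eqP->].
have cards : (#|[pred w | e u w & gdist e w v == 0%N]| +
    #|[pred w | e u w & gdist e w v == 1%N]| +
    #|[pred w | e u w & gdist e w v == 2%N]|)%N = k.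
  rewrite -(srg_degree u) /degree -!sum1_card.
  rewrite [RHS](bigID (fun w => gdist e w v == 0%N)) /= -addnA; congr (_ + _)%N.
  rewrite [RHS](bigID (fun w => gdist e w v == 1%N)) /=; congr (_ + _)%N;
    apply: eq_bigl => w; rewrite !inE -!andbA; congr (_ && _);
    have := srg_gdist_le2 w v; by case: (gdist e w v) => [|[|[|]]].
transitivity (G 0%N *+ #|[pred w | e u w & gdist e w v == 0%N]| +
    G 1%N *+ #|[pred w | e u w & gdist e w v == 1%N]| +
    G 2%N *+ #|[pred w | e u w & gdist e w v == 2%N]|).
  rewrite -!sumE -addrA (bigID (fun w => gdist e w v == 0%N)) /=; congr (_ + _).
  rewrite (bigID (fun w => gdist e w v == 1%N)) /=; congr (_ + _);
    apply: eq_bigl => w; rewrite -!andbA; congr (_ && _);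
    have := srg_gdist_le2 w v; by case: (gdist e w v) => [|[|[|]]].
have card0 : #|[pred w | e u w & gdist e w v == 0%N]| = e u v.
  case euv: (e u v); last first.
    by apply/eqP/pred0P => w /=; rewrite gdist_eq0; case: eqP => [->|]; rewrite ?euv ?andbF.
  rewrite -[RHS](card1 v); apply: eq_card => w; rewrite !inE gdist_eq0.
  by case: eqP => [->|]; rewrite ?euv ?andbF.
have := srg_gdist_le2 u v; case d: (gdist e u v) => [|[|[|//]]] _; move: cards; rewrite card0.
- have /eqP <- : u == v by rewrite -gdist_eq0 d.
  rewrite srg_simple.2 => cards.
  (* Here the target is [u] itself, and all its neighbours are at distance 1. *)
  suff c2 : #|[pred w | e u w & gdist e w u == 2%N]| = 0%N.
    by rewrite c2 addn0 add0n in cards; rewrite c2 cards !mulr0n add0r addr0.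
  apply/eqP/pred0P => w /=; rewrite gdist_srg srg_simple.1.
  by case: (e w u); case: (w == u).
- by move: (d) => /eqP; rewrite gdist_eq1 => -> h; rewrite srg_card_nbr_far // in h *;
    rewrite mulr1n; congr (_ + _ *+ _ + _); have := srg_a_lt; lia.
- have -> : e u v = false by rewrite -gdist_eq1 d.
  move=> h; rewrite srg_card_nbr_near // in h *.
  by rewrite mulr0n add0r; congr (_ + _ *+ _); lia.
Qed.

Lemma srg_c_le : (c <= k)%N.
Proof.
have [u [v d2]] := srg_gdist2_ex.
rewrite -(srg_card_nbr_near d2) -(srg_degree u); apply: subset_leq_card.
by apply/fintype.subsetP => w; rewrite !inE => /andP[].
Qed.

(* Double counting of the edges between the two spheres around u. *)
Lemma srg_count (u : V) : (k * (k - a.+1) + c * k.+1 = c * n)%N.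
Proof.
have k1 : #|[pred w | gdist e w u == 1%N]| = k.
  by rewrite -(srg_degree u); apply: eq_card => w; rewrite !inE gdist_eq1 srg_simple.1.
(* Split the vertices by their distance 0, 1 or 2 from [u]. *)
have k2 : (1 + k + #|[pred w | gdist e w u == 2%N]| = n)%N.
  rewrite -srg_card -(cardC (pred1 u)) card1 -addnA; congr (_ + _)%N.
  rewrite -(cardID [pred w | gdist e w u == 1%N] (predC1 u)) -k1; congr (_ + _)%N;
    apply: eq_card => w; rewrite !inE -gdist_eq0;
    have := srg_gdist_le2 w u; by case: (gdist e w u) => [|[|[|]]].
(* Cancelling [c * k.+1] leaves the number of edges between the spheres, counted from the inner
   sphere on the left and from the outer one on the right. *)
rewrite -k2 mulnDr add1n addnC; congr (_ + _)%N.
transitivity (\sum_(w | gdist e w u == 1%N) \sum_(x | gdist e x u == 2%N) e w x)%N.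
  transitivity (\sum_(w | gdist e w u == 1%N) (k - a.+1))%N.
    by rewrite sum_nat_const k1.
  apply: eq_bigr => w /eqP d1; rewrite -(srg_card_nbr_far d1) -sum1_card.
  rewrite [LHS]big_mkcond [RHS]big_mkcond /=; apply: eq_bigr => x _.
  by rewrite inE; case: (e w x); case: (_ == _).
rewrite exchange_big /=; transitivity (\sum_(w | gdist e w u == 2%N) c)%N; last first.
  by rewrite sum_nat_const mulnC.
apply: eq_bigr => w /eqP d1; rewrite -(srg_card_nbr_near d1) -sum1_card.
rewrite [LHS]big_mkcond [RHS]big_mkcond /=; apply: eq_bigr => x _.
by rewrite inE srg_simple.1; case: (e w x); case: (_ == _).
Qed.

End StronglyRegular.

(** * Real-valued law of total probability *)

Section FiniteValued.
Variables (R : realType) (d : measure_display) (Omega : measurableType d).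
Variables (P : probability Omega R).

Lemma fine_probK A : measurable A -> (fine (P A))%:E = P A.
Proof. by move=> mA; rewrite fineK // fin_num_measure. Qed.

Lemma prob_partition (T : finType) (Y : Omega -> T) A :
  (forall y, measurable [set w | Y w = y]) -> measurable A ->
  fine (P A) = \sum_y fine (P (A `&` [set w | Y w = y])).
Proof.
move=> mY mA; apply: EFin_inj; rewrite -sumEFin fine_probK //.
transitivity (P (\bigcup_(y in [set` enum T]) (A `&` [set w | Y w = y]))).
  congr (P _); apply/seteqP; split => [w Aw|w [y _ []] //].
  by exists (Y w) => //=; rewrite mem_enum.
rewrite measure_fin_bigcup //=; first last.
- by move=> y _; apply: measurableI.
- by move=> y z _ _ [w [[_ <-] [_ <-]]].
rewrite -fsbig_seq ?enum_uniq // big_enum /=; apply: eq_bigr => y _.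
by rewrite fine_probK //; apply: measurableI.
Qed.

End FiniteValued.

(** * The hitting time as a sum of tail indicators *)

Section HittingTime.
Variables (R : realType) (d : measure_display) (Omega : measurableType d).
Variables (V : finType) (X : nat -> Omega -> V) (v : V).

(** The event T > t, where T is the hitting time of [v]. *)
Definition unhit (t : nat) : set Omega :=
  [set w | forall i, (i <= t)%N -> X i w <> v].

(** The indices t < T contribute 1 each and the others 0; if [v] is never visited, all contribute
    and both sides are infinite. *)
Lemma hitting_timeE w :
  hitting_time R X v w = (\sum_(0 <= t <oo) (\1_(unhit t) w)%:E)%E.
Proof.
have ge0 t : (0 <= (\1_(unhit t) w)%:E :> \bar R)%E by rewrite lee_fin indicE.
have [[t0 ht0]|never] := pselect (exists t, X t w = v); last first.
  have -> : hitting_time R X v w = +oo%E.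
    rewrite /hitting_time [X in ereal_inf X](_ : _ = set0) ?ereal_inf0 //.
    by apply/seteqP; split => // x [t /= ht _]; apply: never; exists t.
  apply/esym/eqyP => A A0.
  have [N AN] : exists N, (A <= N%:R)%R.
    by exists (Num.truncn A).+1; apply/ltW/truncnS_gt.
  apply: le_trans (nneseries_lim_ge N _) => //.
  rewrite (eq_bigr (fun=> 1%E)) => [|t _]; last first.
    by rewrite indicE mem_set // => i _ hi; apply: never; exists i.
  by rewrite sumEFin lee_fin sumr_const_nat subn0.
have ex : exists t, `[< X t w = v >] by exists t0; apply/asboolP.
case: (ex_minnP ex) => tau /asboolP htau mintau.
have -> : hitting_time R X v w = (tau%:R)%:E.
  apply/eqP; rewrite eq_le; apply/andP; split.
    by apply: ereal_inf_lbound; exists tau.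
  apply: le_ereal_inf_tmp => _ [t /= ht <-].
  by rewrite lee_fin ler_nat; apply: mintau; apply/asboolP.
have indE t : (\1_(unhit t) w : R) = (t < tau)%N%:R.
  rewrite indicE; congr (_ %:R); congr nat_of_bool; apply/idP/idP.
    move=> /set_mem h; rewrite ltnNge; apply/negP => le; exact: (h tau).
  move=> lt; apply/mem_set => i it hi; have := mintau i (asboolT hi).
  by move: it lt; lia.
rewrite (nneseries_split 0 tau) // add0n eseries0 ?adde0; last first.
  by move=> i ti _ /=; rewrite indE ltnNge ti.
rewrite sumEFin; congr EFin.
rewrite (eq_big_nat _ _ (F2 := fun=> 1)) => [|i /andP[_ it]]; last by rewrite indE it.
by rewrite sumr_const_nat subn0.
Qed.

End HittingTime.

(** * Markov property and the walk killed at the target *)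

Section Markov.
Variables (V : finType) (R : realType) (d : measure_display).
Variables (Omega : measurableType d) (e : rel V) (u v : V).
Variables (P : probability Omega R) (X : nat -> Omega -> V).
Hypothesis hX : simple_random_walk e u P X.

Let mX t y : measurable [set w | X t w = y].
Proof. by case: hX. Qed.

(** Histories up to [t] form a finite type, so every event about them is a finite union of atoms and
    hence measurable. *)
Definition trajectory t w : {ffun 'I_t.+1 -> V} := [ffun i => X (val i) w].

Lemma measurable_trajectory t f : measurable [set w | trajectory t w = f].
Proof.
have -> : [set w | trajectory t w = f] =
    \bigcap_(i in [set: 'I_t.+1]) [set w | X (val i) w = f i].
  apply/seteqP; split => w; first by move=> /= fw i _ /=; rewrite -fw ffunE.
  by move=> h; apply/ffunP => i; rewrite ffunE; apply: h.
by apply: fin_bigcap_measurable => // i _; apply: mX.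
Qed.

Lemma measurable_trajectory_pred t (Q : {ffun 'I_t.+1 -> V} -> Prop) :
  measurable [set w | Q (trajectory t w)].
Proof.
have -> : [set w | Q (trajectory t w)] =
    \bigcup_(f in [set f | Q f]) [set w | trajectory t w = f].
  by apply/seteqP; split => [w Qw|w [f Qf /= fw]]; [exists (trajectory t w)|rewrite fw].
by apply: fin_bigcup_measurable => // f _; apply: measurable_trajectory.
Qed.

(** The definition of the walk prescribes only the probabilities of single histories. Summing over
    those that satisfy [Q] and end at [x] extends the transition rule to any event of the past,
    without conditioning on possibly null events. *)
Lemma markov_property t (Q : {ffun 'I_t.+1 -> V} -> Prop) x y :
  fine (P ([set w | Q (trajectory t w)] `&` [set w | X t w = x]
             `&` [set w | X t.+1 w = y])) =
  fine (P ([set w | Q (trajectory t w)] `&` [set w | X t w = x]))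
    * step_prob R e x y.
Proof.
have mQ := measurable_trajectory_pred Q.
have mQx : measurable ([set w | Q (trajectory t w)] `&` [set w | X t w = x]).
  exact: measurableI.
rewrite (prob_partition P (measurable_trajectory (t := t))); last exact: measurableI.
rewrite [in RHS](prob_partition P (measurable_trajectory (t := t))) // mulr_suml.
apply: eq_bigr => f _.
(* Histories that violate [Q] or do not end at [x] contribute zero on both sides. *)
have [[Qf fx]|nQf] := pselect (Q f /\ f ord_max = x); last first.
  rewrite [X in P X](_ : _ = set0); last first.
    apply/seteqP; split => // w [[[/= Qw xw] _] fw].
    by apply: nQf; rewrite -fw ffunE.
  rewrite [X in _ = fine (P X) * _](_ : _ = set0); last first.
    apply/seteqP; split => // w [[/= Qw xw] fw].
    by apply: nQf; rewrite -fw ffunE.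
  by rewrite measure0 mul0r.
(* The walk hypothesis quantifies over sequences on [nat], so [f] is continued by [y] after time
   [t]. *)
pose g i := if (i <= t)%N then f (inord i) else y.
have gE w : trajectory t w = f <-> forall i, (i <= t)%N -> X i w = g i.
  split => [fw i it|h]; first by rewrite /g it -fw ffunE /= inordK.
  apply/ffunP => i; have it : (i <= t)%N by rewrite -ltnS.
  by rewrite ffunE h // /g it inord_val.
have gt : g t = x.
  by rewrite /g leqnn -fx; congr (f _); apply/val_inj; rewrite /= inordK.
have gt1 : g t.+1 = y by rewrite /g ltnn.
have [_ _ /(_ t g)] := hX; rewrite gt gt1 => hP.
rewrite [X in P X](_ : _ = [set w | forall i, (i <= t.+1)%N -> X i w = g i]); last first.
  apply/seteqP; split => w.
    move=> [[_ /= yw] /= /gE h] i; rewrite leq_eqVlt => /predU1P[->|].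
      by rewrite gt1.
    exact: h.
  move=> /= h; have /gE fw : forall i, (i <= t)%N -> X i w = g i.
    by move=> i it; apply: h; apply: leqW.
  by split=> //; split=> /=; [split=> /=; [rewrite fw|rewrite h ?gt]|rewrite h].
rewrite hP [X in P X](_ : _ = [set w | trajectory t w = f]); last first.
  by apply/seteqP; split => w /gE.
have mf := measurable_trajectory f.
rewrite -(fine_probK P mf) -EFinM /=.
congr (fine (P _) * _); apply/seteqP; split => w /=; last by case.
by move=> fw; have /gE h := fw; rewrite fw h ?gt.
Qed.

Lemma unhit_trajectory t :
  unhit X v t = [set w | forall i, trajectory t w i <> v].
Proof.
apply/seteqP; split => w /= h i.
  by rewrite ffunE; apply: h; rewrite -ltnS; apply: ltn_ord.
by rewrite -ltnS => it; have := h (Ordinal it); rewrite ffunE.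
Qed.

Lemma measurable_unhit t : measurable (unhit X v t).
Proof.
by rewrite unhit_trajectory; apply: (measurable_trajectory_pred (fun f => forall i, f i <> v)).
Qed.

(** The law at time [t] of the walk killed at [v]; its total mass is P(T > t). *)
Definition taboo t y := fine (P (unhit X v t `&` [set w | X t w = y])).

Lemma taboo_ge0 t y : 0 <= taboo t y.
Proof. by apply: fine_ge0. Qed.

Lemma taboo_target t : taboo t v = 0.
Proof.
rewrite /taboo [X in P X](_ : _ = set0) ?measure0 //.
by apply/seteqP; split => // w [h /= hv]; apply: (h t).
Qed.

Lemma sum_taboo t : fine (P (unhit X v t)) = \sum_y taboo t y.
Proof. by apply: prob_partition => //; apply: measurable_unhit. Qed.

(** As [y] differs from [v], it is enough to avoid [v] up to time [t], an event of the past; then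
    split on the position at time [t]. *)
Lemma tabooS t y : y != v ->
  taboo t.+1 y = \sum_x taboo t x * step_prob R e x y.
Proof.
move=> yv; pose A := unhit X v t `&` [set w | X t.+1 w = y].
have -> : taboo t.+1 y = fine (P A).
  congr (fine (P _)); apply/seteqP; split => w [/= h hy]; split => //= i.
    by move=> it; apply: h; apply: leqW.
  rewrite leq_eqVlt => /predU1P[->|]; last exact: h.
  by rewrite hy; apply/eqP.
rewrite (prob_partition P (mX t)); last by apply: measurableI => //; apply: measurable_unhit.
apply: eq_bigr => x _; rewrite /A /taboo unhit_trajectory setIAC.
exact: (markov_property (fun f => forall i, f i <> v)).
Qed.

(** The initial law is concentrated at [u]. The condition [h v = 0] covers [u = v], where the killed
    law is zero from the start. *)
Lemma sum_taboo0 (h : V -> R) : h v = 0 -> \sum_y taboo 0 y * h y = h u.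
Proof.
move=> hv; have [_ P0 _] := hX.
have P0y y : y != u -> P [set w | X 0 w = y] = 0%E.
  move=> yu; apply/eqP; rewrite eq_le measure_ge0 andbT.
  have : (P ([set w | X 0 w = y] `|` [set w | X 0 w = u]) <= 1)%E.
    by apply: probability_le1; apply: measurableU.
  rewrite measureU //; last first.
    by apply/seteqP; split => // w [/= -> /eqP]; apply/negP.
  by rewrite [X in (_ + X <= _)%E]P0 -[X in (_ <= X)%E]add0e leeD2rE.
have unhit0 y : y != v -> unhit X v 0 `&` [set w | X 0 w = y] = [set w | X 0 w = y].
  move=> yv; apply/seteqP; split => w; first by case.
  by move=> /= hy; split => // i; rewrite leqn0 => /eqP->; rewrite hy; apply/eqP.
rewrite (bigD1 u) //= big1 ?addr0 => [|y yu].
  have [->|uv] := eqVneq u v; first by rewrite hv mulr0.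
  by rewrite /taboo unhit0 // P0 mul1r.
have [->|yv] := eqVneq y v; first by rewrite hv mulr0.
by rewrite /taboo unhit0 // P0y // mul0r.
Qed.

End Markov.

(** * First-step equations determine the mean hitting time *)

Section FirstStepAnalysis.
Variables (V : finType) (R : realType) (e : rel V) (v : V) (h : V -> R).
Hypothesis degree_gt0 : forall x, (0 < degree e x)%N.
Hypothesis hv : h v = 0.
Hypothesis hstep : forall x, x != v -> h x = 1 + \sum_y step_prob R e x y * h y.

Lemma sum_step_prob x : \sum_y step_prob R e x y = 1.
Proof.
rewrite /step_prob -big_mkcond sumr_const -[X in _ *+ X]/(degree e x).
by rewrite -(mulr_natr _^-1) mulVf // pnatr_eq0 -lt0n.
Qed.

(* At a minimum other than v, h would be at least 1 plus itself. *)
Lemma first_step_ge0 x : 0 <= h x.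
Proof.
pose m := [arg min_(y < v) h y]%O.
have hm y : h m <= h y by rewrite /m; case: Order.TotalTheory.arg_minP => // i _; apply.
have [mv|/hstep hm1] := eqVneq m v; first by rewrite -hv -mv.
suff : 1 + h m <= h m by rewrite gerDr leNgt ltr01.
rewrite [leRHS]hm1 lerD2l -[leLHS]mul1r -(sum_step_prob m) mulr_suml.
apply: ler_sum => y _; apply: ler_wpM2l => //.
by rewrite /step_prob; case: ifP => // _; rewrite invr_ge0.
Qed.

Variables (d : measure_display) (Omega : measurableType d) (u : V).
Variables (P : probability Omega R) (X : nat -> Omega -> V).
Hypothesis hX : simple_random_walk e u P X.

(** [r t] is P(T > t), and [M t] is E[h(X t); T > t]. *)
Let r t := fine (P (unhit X v t)).
Let M t := \sum_y taboo v P X t y * h y.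

(** Telescoping: by the first-step equation, one step of the killed walk lowers [M] by exactly
    [r t], and [M 0 = h u]. *)
Lemma sum_unhit t : \sum_(0 <= s < t) r s = h u - M t.
Proof.
elim: t => [|t IH]; first by rewrite big_nil /M (sum_taboo0 hX) // subrr.
rewrite big_nat_recr //= IH; suff -> : M t = r t + M t.+1 by ring.
rewrite /r (sum_taboo v hX) /M.
transitivity (\sum_x \sum_y taboo v P X t x * step_prob R e x y * h y + \sum_x taboo v P X t x).
  rewrite -big_split; apply: eq_bigr => x _ /=.
  have [->|xv] := eqVneq x v.
    by rewrite taboo_target hv mulr0 addr0 big1 // => y _; rewrite !mul0r.
  rewrite [in LHS]hstep // mulrDr mulr1 addrC mulr_sumr; congr (_ + _).
  by apply: eq_bigr => y _; rewrite mulrA.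
rewrite addrC; congr (_ + _); rewrite exchange_big; apply: eq_bigr => y _ /=.
(* [tabooS] excludes [y = v], but there both sides vanish because [h v = 0]. *)
have [->|yv] := eqVneq y v; first by rewrite hv mulr0 big1 // => x _; rewrite mulr0.
by rewrite (tabooS hX) // mulr_suml.
Qed.

Lemma average_hitting_timeE : average_hitting_time P X v = (h u)%:E.
Proof.
have r_ge0 t : 0 <= r t by apply: fine_ge0.
have mU := measurable_unhit v hX.
have M_ge0 t : 0 <= M t.
  by apply: sumr_ge0 => y _; rewrite mulr_ge0 ?taboo_ge0 ?first_step_ge0.
(* The partial sums [h u - M t] increase and are bounded by [h u], so the series converges and its
   terms tend to 0. *)
have cvg_r : r @ \oo --> 0.
  apply: cvg_series_cvg_0; apply: nondecreasing_is_cvgn.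
    by apply: nondecreasing_series.
  by exists (h u) => _ [t _ <-]; rewrite /series /= sum_unhit gerBl.
have cvg_M : M @ \oo --> 0.
  (* Since [h] is nonnegative, [C] dominates each of its values, whence [M t <= C * r t]. *)
  pose C := \sum_y h y.
  apply: (@squeeze_cvgr _ _ _ _ (fun=> 0) (fun t => C * r t)).
  - apply: nearW => t; rewrite M_ge0 /= /r (sum_taboo v hX) mulr_sumr.
    apply: ler_sum => y _; rewrite mulrC; apply: ler_wpM2r; first exact: taboo_ge0.
    by rewrite /C (bigD1 y) //= lerDl; apply: sumr_ge0 => z _; apply: first_step_ge0.
  - exact: cvg_cst.
  - by rewrite -[X in _ --> X](mulr0 C); apply: cvgM => //; apply: cvg_cst.
rewrite /average_hitting_time.
under eq_integral do rewrite hitting_timeE.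
(* Sum and integral are interchanged for nonnegative terms, giving E T as the sum of P(T > t). *)
rewrite integral_nneseries //; last first.
  by move=> t; apply/measurable_realfun.measurable_EFinP; apply: measurable_realfun.measurable_indic.
apply: cvg_lim => //; rewrite [X in X @ _ --> _](_ : _ = EFin \o (fun t => h u - M t)).
  apply: cvg_EFin; first exact: nearW.
  by rewrite -[X in _ --> X](subr0 (h u)); apply: cvgB => //; apply: cvg_cst.
apply/funext => t /=; rewrite -sum_unhit -sumEFin; apply: eq_bigr => s _.
by rewrite integral_indic // setIT (fine_probK P).
Qed.

End FirstStepAnalysis.

(** * Sums over neighbours in a Cartesian product *)

Section CartesianNeighbours.
Variables (V V' : finType) (e : rel V) (e' : rel V').
Hypotheses (e_irr : irreflexive e) (e'_irr : irreflexive e').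

(** Irreflexivity makes the two kinds of edges disjoint: an edge moves the second coordinate exactly
    when the first coordinates agree. *)
Lemma sum_cartesian (M : nmodType) (x : V * V') (F : V * V' -> M) :
  \sum_(y | cartesian_product e e' x y) F y =
  \sum_(w | e' x.2 w) F (x.1, w) + \sum_(w | e x.1 w) F (w, x.2).
Proof.
rewrite (bigID (fun y => x.1 == y.1)) /=; congr (_ + _).
  rewrite (reindex_onto (pair x.1) snd) /=; last first.
    by case=> y1 y2 /= /andP[_ /eqP ->].
  by apply: eq_bigl => w; rewrite /cartesian_product /= !eqxx e_irr orbF !andbT.
rewrite (reindex_onto (pair^~ x.2) fst) /=; last first.
  by case=> y1 y2 /= /andP[/orP[/andP[->]//|/andP[_ /eqP ->]]].
apply: eq_bigl => w; rewrite /cartesian_product /= !eqxx !andbT e'_irr andbF /=.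
by case: eqP => [<-|]; rewrite ?e_irr ?andbT.
Qed.

Lemma degree_cartesian x :
  degree (cartesian_product e e') x = (degree e' x.2 + degree e x.1)%N.
Proof. by rewrite /degree -!sum1_card; apply: (sum_cartesian (M := nat)). Qed.

End CartesianNeighbours.

(** * The table of values and its linear system *)

Section HittingTable.
Variables (R : fieldType) (n k a c : R).

(* The hitting time in G x G between vertices whose coordinates are at
   distances i and j in G. *)
Definition hitting_table (i j : nat) : R :=
  match i, j with
  | 0, 0 => 0
  | 0, 1 | 1, 0 => n ^+ 2 - 1
  | 0, _ | _, 0 =>
    (- c * (n ^+ 2 - 1) * (a - 2 * k - 1) + c ^+ 2 * (n ^+ 2 - 1)
       + k * (k + n + 1)) / (c * (- a + c + 2 * k))
  | 1, 1 =>
    (- a * (n ^+ 2 + n - 2) + c * (n ^+ 2 + n - 2) + 2 * k * n ^+ 2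
       + k * n - 4 * k + n ^+ 2 - n) / (- a + c + 2 * k)
  | 1, _ | _, 1 =>
    (c * (- a * (n ^+ 2 + n - 2) + k * (2 * n ^+ 2 + n - 4) + n ^+ 2 - 1)
       + c ^+ 2 * (n ^+ 2 + n - 2) + k * (k + n + 1)) / (c * (- a + c + 2 * k))
  | _, _ =>
    (c * (- a * (n ^+ 2 + n - 2) + k * (2 * n ^+ 2 + n - 4) + n ^+ 2 + n - 2)
       + c ^+ 2 * (n ^+ 2 + n - 2) + k * (2 * k + n + 2)) / (c * (- a + c + 2 * k))
  end.

(* Sum of G over the distances to v of the neighbours of a vertex at distance i
   from v; note b_1 = k - a - 1. *)
Definition nbr_sum (G : nat -> R) (i : nat) : R :=
  match i with
  | 0 => k * G 1
  | 1 => G 0 + a * G 1 + (k - a - 1) * G 2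
  | _ => c * G 1 + (k - c) * G 2
  end.

Hypotheses (k0 : k != 0) (c0 : c != 0) (two0 : 2 != 0 :> R).
Hypothesis D0 : - a + c + 2 * k != 0.
Hypothesis count : k * (k - a - 1) + c * (k + 1) = c * n.

Lemma hitting_tableC i j : hitting_table i j = hitting_table j i.
Proof. by case: i => [|[|i]]; case: j => [|[|j]]. Qed.

(** Once [count] is solved for [n], each case is an identity of rational functions in [k], [a], [c].
    Symmetry leaves five pairs of distances. The factor [(2 * k)^-1] is the step probability in the
    product. *)
Lemma hitting_table_step i j : (i + j != 0)%N ->
  hitting_table i j =
  1 + (2 * k)^-1 * (nbr_sum (hitting_table i) j + nbr_sum (hitting_table j) i).
Proof.
have nE : n = k * (k - a - 1) / c + (k + 1).
  by rewrite -[LHS](mulKf c0) -count; field.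
wlog : i j / (i <= j)%N => [wl ij|].
  have [le|/ltnW le] := leqP i j; first exact: wl.
  by rewrite hitting_tableC [in RHS](addrC (nbr_sum _ j)); apply: wl; rewrite // addnC.
case: i => [|[|i]]; case: j => [|[|j]] //= _ _; rewrite nE; field; by rewrite ?k0 ?c0 ?D0 ?two0.
Qed.

End HittingTable.

(** * Mean hitting times in the Cartesian square *)

Section CartesianSquareOfSRG.
Variables (R : realType) (V : finType) (e : rel V) (n k a c : nat).
Hypothesis hG : strongly_regular e n k a c.

(** The bounds [a < k] and [c <= k] turn the truncated subtractions of [srg_sum_nbr] into
    subtractions in [R]. *)
Lemma nbr_sum_srg (G : nat -> R) u v :
  \sum_(w | e u w) G (gdist e w v) = nbr_sum k%:R a%:R c%:R G (gdist e u v).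
Proof.
rewrite (srg_sum_nbr hG); case: (gdist e u v) => [|[|_]] /=.
- by rewrite mulr_natl.
- by rewrite -!(mulr_natl (G _)) natrB ?(srg_a_lt hG) // -natr1 opprD addrA.
- by rewrite -!(mulr_natl (G _)) natrB ?(srg_c_le hG).
Qed.

Variables (disp : measure_display) (Omega : measurableType disp).
Variables (P : probability Omega R) (X : nat -> Omega -> V * V) (x v : V * V).
Hypothesis hX : simple_random_walk (cartesian_product e e) x P X.

Lemma average_hitting_time_square :
  average_hitting_time P X v =
  (hitting_table n%:R k%:R a%:R c%:R (gdist e x.1 v.1) (gdist e x.2 v.2))%:E.
Proof.
have deg y : degree (cartesian_product e e) y = (2 * k)%N.
  by rewrite (degree_cartesian (srg_simple hG).2 (srg_simple hG).2) !(srg_degree hG) mul2n addnn.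
have k0 : (0 < k)%N := leq_ltn_trans (leq0n a) (srg_a_lt hG).
have gd0 u : gdist e u u = 0%N by apply/eqP; rewrite (gdist_eq0 hG).
(* With the target fixed, the table becomes a function of the starting vertex, the candidate [h] for
   the first-step equations. *)
rewrite -[RHS]/((fun y => hitting_table n%:R k%:R a%:R c%:R
  (gdist e y.1 v.1) (gdist e y.2 v.2)) x)%:E.
apply: average_hitting_timeE hX => [y||y yv].
- by rewrite deg muln_gt0.
- by rewrite !gd0.
have -> (F : V * V -> R) : \sum_z step_prob R (cartesian_product e e) y z * F z =
    (2 * k%:R)^-1 * \sum_(z | cartesian_product e e y z) F z.
  rewrite mulr_sumr [RHS]big_mkcond; apply: eq_bigr => z _.
  by rewrite /step_prob deg natrM; case: ifP; rewrite ?mul0r.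
rewrite (sum_cartesian (srg_simple hG).2 (srg_simple hG).2) /= nbr_sum_srg.
(* Symmetry moves the varying first coordinate into the second argument, the shape that
   [nbr_sum_srg] handles. *)
under eq_bigr do rewrite hitting_tableC.
rewrite nbr_sum_srg; apply: hitting_table_step.
- by rewrite pnatr_eq0 -lt0n.
- by rewrite pnatr_eq0 -lt0n (srg_c_gt0 hG).
- by rewrite pnatr_eq0.
(* The denominator is positive because [a < k]. *)
- have := srg_a_lt hG; rewrite -(ltr_nat R); have : 0 <= c%:R :> R by [].
  have : 0 <= a%:R :> R by [].
  by move=> *; apply: lt0r_neq0; lra.
- have := srg_count hG v.1 => /(congr1 (fun m => m%:R : R)).
  by rewrite natrD !natrM natrB ?(srg_a_lt hG) // -!natr1 opprD addrA.
- by rewrite addn_eq0 !(gdist_eq0 hG) -xpair_eqE -!surjective_pairing.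
Qed.

End CartesianSquareOfSRG.

Theorem corollary5p2 (R : realType) (V : finType) (e : rel V) (n k a c : nat)
  (hG : strongly_regular e n k a c)
  (u1 v1 u2 v2 : V)
  (disp : measure_display) (Omega : measurableType disp)
  (P : probability Omega R) (X : nat -> Omega -> V * V)
  (hX : simple_random_walk (cartesian_product e e) (u2, v2) P X) :
  let d := gdist (cartesian_product e e) (u1, v1) (u2, v2) in
  let H : \bar R := average_hitting_time P X (u1, v1) in
  let n : R := n%:R in
  let k : R := k%:R in
  let a : R := a%:R in
  let c : R := c%:R in
  ((u1, v1) = (u2, v2) -> H = 0%:E) /\
  (d = 1%N -> H = (n ^+ 2 - 1)%:E) /\
  (d = 2%N -> u1 = u2 \/ v1 = v2 ->
    H = ((- c * (n ^+ 2 - 1) * (a - 2 * k - 1) + c ^+ 2 * (n ^+ 2 - 1)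
            + k * (k + n + 1))
         / (c * (- a + c + 2 * k)))%:E) /\
  (d = 2%N -> u1 <> u2 -> v1 <> v2 ->
    H = ((- a * (n ^+ 2 + n - 2) + c * (n ^+ 2 + n - 2) + 2 * k * n ^+ 2
            + k * n - 4 * k + n ^+ 2 - n)
         / (- a + c + 2 * k))%:E) /\
  (d = 3%N ->
    H = ((c * (- a * (n ^+ 2 + n - 2) + k * (2 * n ^+ 2 + n - 4) + n ^+ 2 - 1)
            + c ^+ 2 * (n ^+ 2 + n - 2) + k * (k + n + 1))
         / (c * (- a + c + 2 * k)))%:E) /\
  (d = 4%N ->
    H = ((c * (- a * (n ^+ 2 + n - 2) + k * (2 * n ^+ 2 + n - 4)
                 + n ^+ 2 + n - 2)
            + c ^+ 2 * (n ^+ 2 + n - 2) + k * (2 * k + n + 2))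
         / (c * (- a + c + 2 * k)))%:E).
Proof.
move=> d H N K A C.
(* The walk runs from [(u2, v2)] to [(u1, v1)], whereas [d] takes the vertices in the other order;
   symmetry of the distance reconciles the two. *)
have HE : H = (hitting_table N K A C (gdist e u1 u2) (gdist e v1 v2))%:E.
  by rewrite /H (average_hitting_time_square hG (u1, v1) hX) /= !(gdist_srgC hG u2, gdist_srgC hG v2).
have : d = (gdist e u1 u2 + gdist e v1 v2)%N.
  by apply: gdist_cartesian; exact: srg_connected hG.
(* Equalities of coordinates are expressed through distances, so that every clause depends only on
   the pair [(i, j)]. *)
have eq0 x y : x = y <-> gdist e x y = 0%N.
  split => [->|/eqP]; first by apply/eqP; rewrite (gdist_eq0 hG).
  by rewrite (gdist_eq0 hG) => /eqP.
have eqpair : (u1, v1) = (u2, v2) <-> u1 = u2 /\ v1 = v2 by split => [[-> ->]|[-> ->]].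
move: eqpair (eq0 u1 u2) (eq0 v1 v2) (srg_gdist_le2 hG u1 u2) (srg_gdist_le2 hG v1 v2).
rewrite HE => + + + + + ->; move: (gdist e u1 u2) (gdist e v1 v2) => i j.
(* For each of the nine pairs, a clause is either the table entry itself or has contradictory
   assumptions. *)
case: i => [|[|[|//]]]; case: j => [|[|[|//]]] /= ? ? ? _ _; repeat split; intros;
  first [reflexivity | exfalso; intuition discriminate].
Qed.
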